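(* Let $\mathbf{A}$ be a finite idempotent algebra and let $k>1$ be an integer. The following are equivalent: (1) $\mathbf{A}$ (or equivalently $\mathbf{A}^2$) has a near unanimity term operation of arity $k+2$; (2) every $(k,k+1)$-instance over $\mathbf{A}^2$ is sensitive; (3) every $(k,k+1)$-instance over $\mathbf{A}^2$ with exactly $k+2$ variables is sensitive.
   Context: An $m$-ary operation $n$ on a set $B$ is a near unanimity operation if $n(b,a,\dots,a)=n(a,b,a,\dots,a)=\dots=n(a,\dots,a,b)=a$ for all $a,b\in B$. An algebra is idempotent if every basic operation $f$ satisfies $f(a,\dots,a)=a$. A CSP instance is a pair $(V,\mathcal{C})$ with $V$ a finite set of variables and $\mathcal{C}$ a set of constraints $((x_1,\dots,x_n),R)$ with $x_i\in V$ and $R$ an $n$-ary relation. An instance over an algebra $\mathbf{B}$ has every variable ranging over $B$ and every constraint relation a subuniverse of a finite power of $\mathbf{B}$. A solution is a map $f:V\to B$ with $(f(x_1),\dots,f(x_n))\in R$ for every constraint. For $W\subseteq V$, $\mathcal{I}_{|W}$ is the instance with variable set $W$ and those constraints all of whose variables lie in $W$. An instance is $k$-uniform if all constraints are $k$-ary and every $k$-element set of variables is constrained by a single constraint (the paper tolerates several constraints on the same variable set provided they impose the same restriction up to permuting coordinates). An instance is a $(k,l)$-instance if it is $k$-uniform and for every $l$-element $W\subseteq V$, every tuple in every constraint of $\mathcal{I}_{|W}$ extends to a solution of $\mathcal{I}_{|W}$. An instance is sensitive if every tuple in every constraint relation extends to a solution (equivalently, removing any tuple from any constraint relation invalidates some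 solution). *)

(* Defs.v *)
From mathcomp Require Import all_boot.

Set Implicit Arguments.
Unset Strict Implicit.
Unset Printing Implicit Defensive.

Record signature := Signature {
  symbol :> Type;
  symbol_arity : symbol -> nat
}.

(* Nullary symbols, infinitely many symbols and an empty carrier are allowed. *)
Record finAlgebra (S : signature) := FinAlgebra {
  carrier :> finType;
  basic_op : forall o : S, {ffun 'I_(symbol_arity o) -> carrier} -> carrier
}.

Definition idempotent_algebra S (A : finAlgebra S) : Prop :=
  forall (o : S) (a : A), basic_op (o := o) [ffun=> a] = a.

Definition power S (A : finAlgebra S) (n : nat) : finAlgebra S :=
  @FinAlgebra S {ffun 'I_n -> A}
    (fun o args => [ffun i => basic_op (o := o) [ffun j => args j i]]).

Definition subuniverse S (A : finAlgebra S) (X : {set A}) : Prop :=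
  forall (o : S) (args : {ffun 'I_(symbol_arity o) -> A}),
    (forall j, args j \in X) -> basic_op args \in X.

Inductive term (S : signature) (m : nat) : Type :=
  | Var of 'I_m
  | App (o : S) of ('I_(symbol_arity o) -> term S m).

Fixpoint eval S (A : finAlgebra S) m (t : term S m) (v : {ffun 'I_m -> A}) : A :=
  match t with
  | Var i => v i
  | App o args => basic_op (o := o) [ffun j => eval (args j) v]
  end.

Definition term_operation S (A : finAlgebra S) m
    (f : {ffun 'I_m -> A} -> A) : Prop :=
  exists t : term S m, forall v, f v = eval t v.

Definition near_unanimity (B : finType) m (f : {ffun 'I_m -> B} -> B) : Prop :=
  forall (i : 'I_m) (a b : B), f [ffun j => if j == i then b else a] = a.

Definition has_near_unanimity_term S (A : finAlgebra S) (m : nat) : Prop :=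
  exists f : {ffun 'I_m -> A} -> A, term_operation f /\ near_unanimity f.

Record constraint (V B : finType) := Constraint {
  arity : nat;
  scope : {ffun 'I_arity -> V};
  relation : {set {ffun 'I_arity -> B}}
}.

Record instance (B : finType) := Instance {
  variable : finType;
  constraints : constraint variable B -> Prop
}.

Definition instance_over S (B : finAlgebra S) (I : instance B) : Prop :=
  forall c, constraints (i := I) c ->
    subuniverse (A := power B (arity c)) (relation c).

Definition solution (B : finType) (I : instance B) (f : variable I -> B) : Prop :=
  forall c, constraints c -> [ffun i => f (scope c i)] \in relation c.

Definition sensitive (B : finType) (I : instance B) : Prop :=
  forall c : constraint (variable I) B, constraints c ->
  forall t, t \in relation c ->
  exists f, solution f /\ forall i, f (scope c i) = t i.

(* A constraint with scope in the subtype W belongs to the restriction iff its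
   image under the inclusion of W belongs to I. *)
Definition restrict (B : finType) (I : instance B) (W : {set variable I}) :
    instance B :=
  @Instance B {x : variable I | x \in W}
    (fun c => constraints (Constraint [ffun i => val (scope c i)] (relation c))).

(* Scopes consist of k distinct variables; several constraints may share their
   set of variables if they agree up to the induced permutation of coordinates.
   The indices of c and d are related by a bijection s, rather than by a
   permutation of 'I_k, only to avoid casts along arity c = k = arity d. *)
Definition uniform (k : nat) (B : finType) (I : instance B) : Prop :=
  [/\ forall c, constraints (i := I) c -> arity c = k /\ injective (scope c),
      forall W : {set variable I}, #|W| = k ->
        exists2 c, constraints c & [set scope c i | i : 'I_(arity c)] = W
    & forall c d, constraints (i := I) c -> constraints d ->
      forall s : 'I_(arity d) -> 'I_(arity c), bijective s ->
        (forall i, scope d i = scope c (s i)) ->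
      forall t, (t \in relation c) = ([ffun i => t (s i)] \in relation d)].

Definition kl_instance (k l : nat) (B : finType) (I : instance B) : Prop :=
  uniform k I /\
  forall W : {set variable I}, #|W| = l -> sensitive (restrict W).

(* Main.v *)
(* From a near unanimity term t of arity k+2 to sensitivity: a tuple a on a set U of
   k variables is extended to larger and larger sets Z of variables. By
   Baker-Pixley, a system of requirements "the tuple of the constraint W takes the
   value a_p at p" is satisfiable once every k+1 of them are; since 2k > k+1,
   some p in U is then required at most once, and requirements that do not mention
   p are met by a solution on Z minus p. The tuples of different constraints are
   unrelated on U, so a constraint is satisfied for itself; two assignments
   satisfying different constraints are merged one variable y at a time. Their
   possible values at y form a binary relation which absorbs the equality
   through t, Baker-Pixley provides arbitrarily long walks in it, and a loop lemma
   turns these into a loop, that is, into a common value at y.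

   Conversely, let Q be a subpower of A with exponent k+2 and let a tuple a agree
   with members of Q outside any single coordinate. Arranging four coordinates as a
   2 x 2 square, whose rows and columns become variables over A^2, gives a
   (k,k+1)-instance on k+2 variables in which the tuple given by a extends to a
   solution only if a is in Q. Hence subpowers of A are determined by
   their (k+1)-fold projections, and the near unanimity identities hold as soon as
   any k+1 of their instances do. *)

Require Import Defs.
From mathcomp Require Import all_boot.
From mathcomp.classical Require Import boolp.
From mathcomp Require Import zify.

Set Implicit Arguments.
Unset Strict Implicit.
Unset Printing Implicit Defensive.

Lemma increasing_sets_stabilize (T : finType) (F : nat -> {set T}) :
  (forall i, F i \subset F i.+1) -> exists i, F i = F i.+1.
Proof.
move=> incF; apply: contrapT => strictF.
have card_ge i : i <= #|F i|.
  elim: i => // i IHi; apply: leq_ltn_trans IHi (proper_card _).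
  rewrite properEneq incF andbT; apply/eqP => eqF; apply: strictF; by exists i.
by have := leq_trans (card_ge #|T|.+1) (max_card _); rewrite ltnn.
Qed.

(** * A loop lemma for relations absorbing the equality *)

Section LoopLemma.

Variables (B : finType) (m : nat) (t : {ffun 'I_m -> B} -> B) (E : rel B).
Hypothesis m_gt0 : 0 < m.
Hypothesis t_idem : forall b, t [ffun=> b] = b.
Hypothesis E_closed : forall u v : {ffun 'I_m -> B},
  (forall j, E (u j) (v j)) -> E (t u) (t v).
(** One coordinate may stand still; the edge from [u i] to [z] records that [u i] lies in the domain
    of [E]. *)
Hypothesis E_absorbs_diag : forall (u v : {ffun 'I_m -> B}) i z,
  (forall j, j != i -> E (u j) (v j)) -> u i = v i -> E (u i) z ->
  E (t u) (t v).

Definition op_closed (X : {set B}) :=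
  forall u : {ffun 'I_m -> B}, (forall j, u j \in X) -> t u \in X.

Definition successors (X Z : {set B}) := [set y in X | [exists z in Z, E z y]].

Lemma successorsP (X Z : {set B}) y :
  reflect (y \in X /\ exists2 z, z \in Z & E z y) (y \in successors X Z).
Proof.
rewrite inE; apply: (iffP andP) => -[yX].
  by case/exists_inP=> z; split=> //; exists z.
by case=> z zZ Ezy; split=> //; apply/exists_inP; exists z.
Qed.

Lemma successors_sub (X Z : {set B}) : successors X Z \subset X.
Proof. by apply/subsetP=> y /successorsP[]. Qed.

Lemma successorsS (X Z Z' : {set B}) :
  Z \subset Z' -> successors X Z \subset successors X Z'.
Proof.
move=> /subsetP sZ; apply/subsetP=> y /successorsP[yX [z zZ Ezy]].
by apply/successorsP; split=> //; exists z => //; apply: sZ.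
Qed.

Lemma iter_successorsS (X Z Z' : {set B}) n : Z \subset Z' ->
  iter n (successors X) Z \subset iter n (successors X) Z'.
Proof. by move=> sZ; elim: n => //= n; apply: successorsS. Qed.

Lemma iter_successors_sub (X Z : {set B}) n :
  Z \subset X -> iter n (successors X) Z \subset X.
Proof. by move=> sZ; case: n => //= n; apply: successors_sub. Qed.

Lemma iter_successors_closed X Z n : op_closed X -> op_closed Z ->
  op_closed (iter n (successors X) Z).
Proof.
move=> clX clZ; elim: n => //= n IHn u uS.
apply/successorsP; split.
  by apply: clX => j; have /successorsP[] := uS j.
have /fin_all_exists2[z zZ Ezu] : forall j, exists2 z,
    z \in iter n (successors X) Z & E z (u j).
  by move=> j; have /successorsP[] := uS j.
exists (t [ffun j => z j]); first by apply: IHn => j; rewrite ffunE.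
by apply: E_closed => j; rewrite ffunE.
Qed.

Definition backward (X : {set B}) :=
  forall y, y \in X -> exists2 x, x \in X & E x y.

(** A choice of predecessors is a map [f] on [X]; the orbit of a point enters a cycle, and the walk
    runs around it against [f]. *)
Lemma backward_periodic_walk X : X != set0 -> backward X ->
  exists (w : nat -> B) (l : nat), [/\ 0 < l,
    forall n, w n \in X, forall n, E (w n) (w n.+1)
    & forall n q, w (n + q * l) = w n].
Proof.
case/set0Pn=> x xX bX.
have {bX} [f fP] : exists f : B -> B,
    forall y, y \in X -> f y \in X /\ E (f y) y.
  apply: (@fin_all_exists _ (fun=> B)
    (fun y z => y \in X -> z \in X /\ E z y)) => y.
  case: (boolP (y \in X)) => [/bX[z zX Ezy] | _]; first by exists z.
  by exists y.
have iterX n z : z \in X -> iter n f z \in X.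
  by move=> zX; elim: n => //= n /fP[].
have /trajectP[i i_lt eq_i] := looping_order f x.
set z := iter i f x in eq_i; set l := fingraph.order f x - i.
have l_gt0 : 0 < l by rewrite subn_gt0.
have iter_l : iter l f z = z.
  by rewrite -[RHS]eq_i -iterD subnK // ltnW.
have iter_ql q : iter (q * l) f z = z.
  by elim: q => // q IHq; rewrite mulSn iterD IHq.
have zX : z \in X by apply: iterX.
(* Since [l] steps along [f] lead from [z] back to [z], [l.-1] steps undo a single one. *)
exists (fun n => iter (n * l.-1) f z), l; split=> // [n | n | n q].
- exact: iterX.
- have -> : iter (n * l.-1) f z = f (iter (n.+1 * l.-1) f z).
    rewrite -iterS -[in LHS]iter_l -iterD; congr (iter _ f z).
    by rewrite mulSn -addSn prednK // addnC.
  by have /fP[] := iterX (n.+1 * l.-1) z zX.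
- rewrite mulnDl iterD -mulnA (mulnC l) mulnA.
  by rewrite iter_ql.
Qed.

(* Each coordinate of the constant tuple (w 0, ..., w 0) follows w, the j-th one
   pausing at time j; at most one coordinate pauses at any time, so
   applying t yields a closed walk whose length is one more than a period. *)
Lemma paused_walk X (w : nat -> B) T : op_closed X ->
  (forall n, w n \in X) -> (forall n, E (w n) (w n.+1)) -> m <= T ->
  w T \in iter T.+1 (successors X) [set w 0].
Proof.
move=> clX wX Ew le_mT.
pose U n := [ffun j : 'I_m => w (n - (j < n))].
have UF n : t (U n) \in iter n (successors X) [set w 0].
  elim: n => [|n IHn].
    have -> : U 0 = [ffun=> w 0] by apply/ffunP=> j; rewrite !ffunE.
    by rewrite t_idem set11.
  rewrite iterS; apply/successorsP; split; first by apply: clX => j; rewrite ffunE.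
  exists (t (U n)) => //.
  have moves (j : 'I_m) : (j != n :> nat) -> E (U n j) (U n.+1 j).
    move=> jn; rewrite !ffunE ltnS (leq_eqVlt j n) (negPf jn) /=.
    have -> : n.+1 - (j < n) = (n - (j < n)).+1 by case: ltnP; lia.
    exact: Ew.
  have [lt_nm | le_mn] := ltnP n m.
    apply: (@E_absorbs_diag _ _ (Ordinal lt_nm) (w n.+1)) => [j||].
    - by rewrite -val_eqE; apply: moves.
    - by rewrite !ffunE /= ltnn ltnSn subn0 subn1.
    - by rewrite ffunE /= ltnn subn0.
  apply: E_closed => j; apply: moves.
  by rewrite neq_ltn (leq_trans (ltn_ord j) le_mn).
have -> : w T = t (U T.+1); last exact: UF.
have -> : U T.+1 = [ffun=> w T]; last by rewrite t_idem.
apply/ffunP=> j; rewrite !ffunE ltnS (leq_trans (ltnW (ltn_ord j)) le_mT).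
by rewrite subn1.
Qed.

(** Return times to [c] are closed under addition, and the coprime numbers [L] and [L.+1] generate
    every number from [L * L] on. *)
Lemma returns_eventually X c L : 0 < L ->
  c \in iter L (successors X) [set c] ->
  c \in iter L.+1 (successors X) [set c] ->
  forall j, L * L <= j -> c \in iter j (successors X) [set c].
Proof.
move=> L_gt0 cL cL1.
have cD a b : c \in iter a (successors X) [set c] ->
    c \in iter b (successors X) [set c] ->
    c \in iter (a + b) (successors X) [set c].
  move=> ca cb; rewrite iterD; apply: (subsetP (iter_successorsS X a _)) ca.
  by rewrite sub1set.
have cM a q : c \in iter a (successors X) [set c] ->
    c \in iter (q * a) (successors X) [set c].
  by move=> ca; elim: q => [|q IHq]; rewrite ?set11 // mulSn; apply: cD.
move=> j le_j.
have -> : j = (j %/ L - j %% L) * L + j %% L * L.+1.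
  have le_q : L <= j %/ L by rewrite leq_divRL.
  have lt_r := ltn_pmod j L_gt0.
  have := divn_eq j L; nia.
by apply: cD; apply: cM.
Qed.

(** Induction on the size of [X]: among the sets reached from [c] in a given number of steps, some
    [Z] equals its own successors. If [Z] is proper, it replaces [X]; otherwise the last stage
    before [X] is first reached does. *)
Lemma loop_of_backward X : X != set0 -> op_closed X -> backward X ->
  exists c, E c c.
Proof.
have [n] := ubnP #|X|; elim: n X => // n IHn X le_Xn X0 clX bX.
have [w [l [l_gt0 wX Ew w_per]]] := backward_periodic_walk X0 bX.
set c := w 0; pose F j := iter j (successors X) [set c].
have cX : [set c] \subset X by rewrite sub1set; apply: wX.
have F_closed j : op_closed (F j).
  apply: iter_successors_closed => // u uc.
  have -> : u = [ffun=> c] by apply/ffunP=> i; rewrite ffunE; apply/set1P.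
  by rewrite t_idem set11.
have FX j : F j \subset X by apply: iter_successors_sub.
have wF j : w j \in F j.
  elim: j => [|j IHj]; first by rewrite set11.
  by apply/successorsP; split=> //; exists (w j).
have F0 j : F j != set0 by apply/set0Pn; exists (w j).
have shrink Z : Z != set0 -> op_closed Z -> Z \subset X -> Z != X ->
    Z \subset successors X Z -> exists c, E c c.
  move=> Z0 clZ ZX ZneX /subsetP bZ; apply: (IHn Z) => //.
    by rewrite (leq_trans _ (le_Xn : #|X| <= n)) // proper_card // properEneq ZneX.
  by move=> y /bZ/successorsP[].
(* A multiple of the period, so that [w] is back at [c], and at least [m], as [paused_walk]
   requires. *)
pose L := m * l; pose J := L * L.
have w_L : w L = c by rewrite -[L]add0n w_per.
have cF j : J <= j -> c \in F j.
  apply: returns_eventually; first by rewrite muln_gt0 m_gt0.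
    by have := wF L; rewrite w_L.
  have := @paused_walk X w L clX wX Ew; rewrite w_L; apply.
  by rewrite leq_pmulr.
have F_incr a j : J <= j -> F a \subset F (a + j).
  by move=> /cF cj; rewrite /F iterD iter_successorsS ?sub1set.
(* Stages at distance at least [J] increase. The increment [J + J.+1] leaves room for both [a + J]
   and [a + J.+1] between two equal stages, so these two consecutive stages coincide. *)
have [i eqF] : exists i, F (i * (J + J.+1)) = F (i.+1 * (J + J.+1)).
  apply: (@increasing_sets_stabilize _ (fun i => F (i * (J + J.+1)))) => i.
  by rewrite mulSnr; apply: F_incr; rewrite leq_addr.
set a := i * _ in eqF; pose Z := F (a + J).
have a2 : i.+1 * (J + J.+1) = a + J + J.+1 by rewrite mulSn -/a; lia.
have Z_fix : successors X Z = Z.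
  have eq1 : Z = F a.
    apply/eqP; rewrite eqEsubset [F a \subset _]F_incr // andbT eqF a2.
    exact: F_incr.
  have eq2 : F (a + J.+1) = F a.
    apply/eqP; rewrite eqEsubset [F a \subset _]F_incr // andbT eqF.
    have -> : i.+1 * (J + J.+1) = a + J.+1 + J by rewrite a2; lia.
    exact: F_incr.
  by rewrite eq1 -[RHS]eq2 addnS -/(F a) -eq1.
have [ZX | ZneX] := eqVneq Z X; last first.
  by apply: (shrink Z (F0 _) (F_closed _) (FX _) ZneX); rewrite Z_fix.
have ex_i : exists i, F i == X by exists (a + J); apply/eqP.
(* If [X] is stage 0, it is the singleton of [c], whose predecessor must be [c]. Otherwise the stage
   just before the first one equal to [X] is proper and has all of [X] as its successors. *)
case: (ex_minnP ex_i) => -[|j] /eqP Fj minj.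
  have [x] := bX c (wX 0); rewrite -Fj => /set1P-> Ecc; by exists c.
apply: (shrink (F j) (F0 _) (F_closed _) (FX _)).
  by apply/eqP=> /eqP/minj; rewrite ltnn.
by have := FX j; rewrite -{1}Fj.
Qed.

(** The endpoints of walks of length [i] form decreasing nonempty sets; where these stabilize, every
    element has a predecessor in the set. *)
Lemma loop_of_long_walks :
  (forall N, exists w : nat -> B, forall i, i < N -> E (w i) (w i.+1)) ->
  exists c, E c c.
Proof.
move=> walk; pose F i := iter i (successors setT) setT.
have F_decr i : F i.+1 \subset F i.
  by rewrite /F iterSr; apply: iter_successorsS; apply: subsetT.
have [i /setC_inj eqF] : exists i, ~: F i = ~: F i.+1.
  apply: (@increasing_sets_stabilize _ (fun i => ~: F i)) => i.
  by rewrite setCS.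
apply: (@loop_of_backward (F i)).
- have [w Ew] := walk i; apply/set0Pn; exists (w i).
  have : forall j, j <= i -> w j \in F j.
    elim=> [|j IHj] le_j; first by rewrite inE.
    by apply/successorsP; split; rewrite ?inE //; exists (w j); auto.
  exact.
- by apply: iter_successors_closed => u _; rewrite inE.
- by move=> y; rewrite {1}eqF => /successorsP[].
Qed.

End LoopLemma.

(** * Extending solutions with a near unanimity operation *)

Lemma near_unanimityP (B : finType) m (t : {ffun 'I_m -> B} -> B) :
  near_unanimity t -> forall (u : {ffun 'I_m -> B}) i b,
  (forall j, j != i -> u j = b) -> t u = b.
Proof.
move=> t_nu u i b ub; rewrite -[RHS](t_nu i b (u i)); congr t.
by apply/ffunP=> j; rewrite ffunE; case: eqVneq => [->|/ub].
Qed.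

(** Of [m] functions, each correct on [Y] except perhaps at its own chosen point, at most one errs
    at any given point, and [t] outvotes it. *)
Lemma baker_pixley (B D : finType) m (t : {ffun 'I_m -> B} -> B)
    (K : (D -> B) -> Prop) (f : D -> B) (X : {set D}) :
  0 < m ->
  near_unanimity t ->
  (forall F : 'I_m -> D -> B, (forall j, K (F j)) ->
     K (fun x => t [ffun j => F j x])) ->
  (forall Y : {set D}, Y \subset X -> #|Y| < m ->
     exists2 g, K g & {in Y, g =1 f}) ->
  exists2 g, K g & {in X, g =1 f}.
Proof.
move=> m_gt0 t_nu K_closed Kf.
suff: forall Y : {set D}, Y \subset X -> exists2 g, K g & {in Y, g =1 f}.
  by apply.
move=> Y; have [n] := ubnP #|Y|; elim: n Y => // n IHn Y le_Yn YX.
have [lt_Ym | le_mY] := ltnP #|Y| m; first exact: Kf.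
pose e (j : 'I_m) : D := enum_val (widen_ord le_mY j).
have eY j : e j \in Y by apply: enum_valP.
have e_inj : injective e.
  by move=> i j /enum_val_inj/(congr1 val)/= /val_inj.
have /fin_all_exists2[F KF Ff] : forall j, exists2 g,
    K g & {in Y :\ e j, g =1 f}.
  move=> j; apply: IHn; last exact: subset_trans (subD1set _ _) YX.
  by rewrite (cardsD1 (e j)) eY in le_Yn.
exists (fun x => t [ffun j => F j x]) => [|x xY]; first exact: K_closed.
have [/existsP[i /eqP eix] | /existsPn nex] := boolP [exists i, e i == x].
  apply: (near_unanimityP t_nu (i := i)) => j ji; rewrite ffunE Ff // !inE xY andbT -eix.
  by rewrite (inj_eq e_inj) eq_sym.
apply: (near_unanimityP t_nu (i := Ordinal m_gt0)) => j _.
by rewrite ffunE Ff // !inE xY andbT eq_sym.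
Qed.

(** Double counting: otherwise every element of [U] would be counted at least twice. Elements of [L]
    are charged once in advance. *)
Lemma sparse_index (T V : finType) (idx : T -> V) (X : {set T})
    (U L : {set V}) :
  #|X| + #|L| < 2 * #|U| ->
  exists2 p, p \in U & #|[set x in X | idx x == p]| + (p \in L) <= 1.
Proof.
move=> ltXU; apply: contrapT => nex; move: ltXU; apply/negP; rewrite -leqNgt.
have -> : 2 * #|U| = \sum_(p in U) 2 by rewrite sum_nat_const mulnC.
apply: (@leq_trans (\sum_(p in U)
    (#|[set x in X | idx x == p]| + (p \in L)))).
  apply: leq_sum => p pU; rewrite ltnNge; apply/negP => le1.
  by apply: nex; exists p.
rewrite big_split leq_add //.
  rewrite -[leqRHS]sum1_card (partition_big idx predT) //=.
  rewrite [leqRHS](bigID (mem U)) /= -[leqLHS]addn0 leq_add //.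
  apply: leq_sum => p _; rewrite -sum1_card.
  by apply: eq_leq; apply: eq_bigl => x; rewrite inE.
rewrite -[leqRHS]sum1_card [leqRHS]big_mkcond [leqLHS]big_mkcond /=.
by apply: leq_sum => p _; case: ifP; case: ifP.
Qed.

Section LocalToGlobal.

Variables (V B : finType) (k : nat) (t : {ffun 'I_(k + 2) -> B} -> B).
Variable R : {set V} -> (V -> B) -> Prop.
Hypothesis k_gt1 : 1 < k.
Hypothesis t_nu : near_unanimity t.
Hypothesis R_local : forall (W : {set V}) f g, {in W, f =1 g} -> R W f -> R W g.
Hypothesis R_closed : forall W (F : 'I_(k + 2) -> V -> B),
  (forall j, R W (F j)) -> R W (fun v => t [ffun j => F j v]).

Definition solves (Z : {set V}) (f : V -> B) :=
  forall W : {set V}, W \subset Z -> #|W| = k -> R W f.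

(** This is the condition on sets of [k + 1] variables, applied to [v |: W]. *)
Hypothesis R_extends : forall (W : {set V}) v f, #|W| = k -> v \notin W ->
  R W f -> exists2 g, {in W, g =1 f} & solves (v |: W) g.

Let arity_gt0 : 0 < k + 2. Proof. by rewrite addn2. Qed.

Section InductionStep.

Variables (Z U : {set V}) (a : V -> B).
Hypotheses (UZ : U \proper Z) (cardU : #|U| = k) (RUa : R U a).
Hypothesis IH : forall (Z' U' : {set V}) a', Z' \proper Z -> U' \subset Z' ->
  #|U'| = k -> R U' a' -> exists2 f, {in U', f =1 a'} & solves Z' f.

(* A cell x carries an assignment [x None] of the variables outside U and, for
   every scope W, a tuple [x (Some W)] of the constraint on W which agrees with
   it outside U; on U the tuples of different constraints are unrelated. *)
Definition cell := option {set V} -> V -> B.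

Definition valid (x : cell) := forall W : {set V}, W \subset Z -> #|W| = k ->
  R W (x (Some W)) /\ {in W :\: U, x (Some W) =1 x None}.

Definition fixes (P : pred {set V}) (x : cell) := forall W : {set V},
  W \subset Z -> #|W| = k -> P W -> {in W :&: U, x (Some W) =1 a}.

(** Inside [Z] these are the scopes contained in some [y |: U]; a compatible value at [y] satisfies
    all of those at once. *)
Definition near_base (W : {set V}) := #|W :\: U| <= 1.

Definition base_ext c v := if v \in U then a v else c.

Definition compatible y c := solves (y |: U) (base_ext c).

Lemma valid_comb (F : 'I_(k + 2) -> cell) : (forall j, valid (F j)) ->
  valid (fun o v => t [ffun j => F j o v]).
Proof.
move=> vF W WZ cW; split; first by apply: R_closed => j; have [] := vF j W WZ cW.
move=> v vW; congr t; apply/ffunP=> j; rewrite !ffunE.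
by have [_] := vF j W WZ cW; apply.
Qed.

Lemma exists_compatible y : y \notin U -> exists c, compatible y c.
Proof.
move=> yU; have [g ga sg] := R_extends cardU yU RUa.
exists (g y) => W WyU cW; apply: R_local (sg W WyU cW) => v vW.
rewrite /base_ext; case: ifPn => [/ga // | vU].
by have := subsetP WyU v vW; rewrite !inE (negPf vU) orbF => /eqP->.
Qed.

(** Scopes inside [y |: U] are near the base, so there the tuples of [x] are [a] on [U] and
    [x None y] at [y]. *)
Lemma compatible_of_fixes x y : valid x -> fixes near_base x ->
  y \in Z -> compatible y (x None y).
Proof.
move=> vx fx yZ W WyU cW.
have WZ : W \subset Z.
  by apply: subset_trans WyU _; rewrite subUset sub1set yZ proper_sub.
have WU : W :\: U \subset [set y].
  apply/subsetP=> v; rewrite !inE => /andP[vU vW].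
  by have := subsetP WyU v vW; rewrite !inE (negPf vU) orbF.
have nW : near_base W by rewrite /near_base (leq_trans (subset_leq_card WU)) ?cards1.
have [RW Wx] := vx W WZ cW; apply: R_local RW => v vW.
rewrite /base_ext; case: ifPn => vU; first by apply: fx; rewrite ?inE ?vW.
have vWU : v \in W :\: U by rewrite inE vU vW.
by rewrite Wx //; have := subsetP WU v vWU; rewrite inE => /eqP->.
Qed.

Lemma near_base_sub (W : {set V}) : near_base W -> W \subset Z ->
  exists2 y, y \in Z :\: U & W \subset y |: U.
Proof.
have /properP[_ [z zZ zU]] := UZ; have zY : z \in Z :\: U by rewrite inE zU zZ.
rewrite /near_base leq_eqVlt ltnS leqn0 cards_eq0 => /orP[/cards1P[y Wy]|W0] WZ.
  exists y.
    have: y \in W :\: U by rewrite Wy set11.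
    by rewrite !inE => /andP[-> /(subsetP WZ)].
  by rewrite -Wy; apply/subsetP=> v vW; rewrite !inE vW andbT orNb.
exists z => //; apply: subset_trans (subsetUr _ _).
by rewrite -setD_eq0.
Qed.

(* The assignment is a solution on Z minus p, which exists by induction: the
   k-tuple of the values at y and at U minus p belongs to its constraint. *)
Lemma omit_cell p y c : p \in U -> y \in Z :\: U -> compatible y c ->
  exists x, [/\ valid x, x None y = c
    & forall W : {set V}, W \subset Z -> #|W| = k ->
      {in W :&: U, forall s, s != p \/ W \subset y |: U -> x (Some W) s = a s}].
Proof.
move=> pU; rewrite inE => /andP[yU yZ] cy; set U' := y |: (U :\ p).
have pZ : p \in Z by apply: (subsetP (proper_sub UZ)).
have py : p != y by apply: contraNneq yU => <-.
have cU' : #|U'| = k.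
  by rewrite cardsU1 !inE (negPf yU) andbF /= -cardU (cardsD1 p U) pU.
have U'U : U' \subset y |: U by rewrite setUS ?subD1set.
have [||||f fa sf] := IH (Z' := Z :\ p) (U' := U') (a' := base_ext c).
- by rewrite properD1.
- apply/subsetP=> v; rewrite !inE => /orP[/eqP->|/andP[-> vU]].
    by rewrite eq_sym py.
  by apply: (subsetP (proper_sub UZ)).
- exact: cU'.
- exact: cy.
have /fin_all_exists[x0 x0P] : forall W : {set V}, exists g,
    W \subset Z -> #|W| = k -> R W g /\ {in W :\ p, g =1 f}.
  move=> W; have [WZ | ] := boolP (W \subset Z); last by exists f.
  have [cW | ] := eqVneq #|W| k; last by move=> /eqP nk; exists f.
  have [pW | pW] := boolP (p \in W); last first.
    exists f => _ _; split=> //; apply: sf => //.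
    by rewrite subsetD1 WZ pW.
  (* [f] is no solution at [p], but it satisfies the scope obtained from [W] by exchanging [p] for
     some [v] outside [W]; [R_extends] then supplies a value at [p]. *)
  have /properP[_ [v vZ vW]] : W \proper Z.
    by rewrite properEcard WZ cW -cardU proper_card.
  have vp : v != p by apply: contraNneq vW => ->.
  have cW' : #|v |: (W :\ p)| = k.
    by rewrite cardsU1 !inE (negPf vW) andbF /= -cW (cardsD1 p W) pW.
  have [||g gf sg] := R_extends (v := p) (f := f) cW'.
  - by rewrite !inE eqxx orbF eq_sym.
  - apply: sf => //; apply/subsetP=> w; rewrite !inE => /orP[/eqP->|/andP[-> wW]].
      by rewrite vp.
    exact: (subsetP WZ).
  exists g => _ _; split=> [|w wW]; last by apply: gf; rewrite inE wW orbT.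
  apply: sg => //; apply/subsetP=> w wW; rewrite !inE wW andbT.
  by case: eqP => //=; rewrite orbT.
have fy : f y = c by rewrite fa ?inE ?eqxx // /base_ext (negPf yU).
(* Scopes inside [y |: U] use [base_ext c], which is correct even at [p]. *)
exists (fun o : option {set V} => if o is Some W then
    if W \subset y |: U then base_ext c else x0 W else f).
split=> // W WZ cW.
  case: ifP => [WyU | _]; last first.
    have [RW xf] := x0P W WZ cW; split=> // v.
    rewrite inE => /andP[vU vW]; apply: xf; rewrite !inE vW andbT.
    by apply: contraNneq vU => ->.
  split=> [|v]; first exact: cy.
  rewrite inE => /andP[vU vW]; have := subsetP WyU v vW.
  by rewrite !inE (negPf vU) orbF => /eqP->; rewrite /base_ext (negPf yU) fy.
move=> s; rewrite inE => /andP[sW sU].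
case: ifP => [_ _ | WyU]; first by rewrite /base_ext sU.
case=> // sp; have [_ ->] := x0P W WZ cW; last by rewrite !inE sp sW.
by rewrite fa ?inE ?sp ?sU ?orbT // /base_ext sU.
Qed.

(* Here the arity k + 2 matters: if W0 has two elements outside U then it has at most
   k - 2 in U, so among k + 1 requirements some p in U occurs at most once and
   not in W0. *)
Lemma fix_one_constraint (W0 : {set V}) : #|W0| = k ->
  exists2 x, valid x & fixes (predU near_base (pred1 W0)) x.
Proof.
move=> cW0; pose P := predU near_base (pred1 W0).
pose X := [set d : option {set V} * V | if d.1 is Some W then
  [&& W \subset Z, #|W| == k, P W & d.2 \in W :&: U] else false].
have [||||g Kg gX] := @baker_pixley B _ _ t
  (fun g => valid (fun o v => g (o, v))) (fun d => a d.2) X.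
- exact: arity_gt0.
- exact: t_nu.
- by move=> F KF; apply: (valid_comb KF).
- move=> Y /subsetP YX; rewrite addn2 ltnS => cY.
  (* Charging the elements of [W0] once more ensures that only a near-base scope can require the
     chosen [p]. *)
  pose L := if near_base W0 then set0 else W0 :&: U.
  have cL : #|L| + 2 <= k.
    rewrite /L; case: ifP => [_ | /negbT]; first by rewrite cards0.
    by rewrite /near_base -ltnNge -cW0 -(cardsID U W0) leq_add2l.
  have [|p pU le1] := @sparse_index _ _ snd Y U L; first by rewrite cardU; lia.
  (* The one scope that may require [p] is to lie in [y |: U], where the cell of [omit_cell] is
     correct at [p] too. *)
  have [y yY Yp] : exists2 y, y \in Z :\: U &
      forall W, (Some W, p) \in Y -> W \subset y |: U.
    have [/existsP[W WY] | /existsPn nW] := boolP [exists W, (Some W, p) \in Y].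
      have := YX _ WY; rewrite inE /= => /and4P[WZ _ PW pWU].
      have uniqW d : d \in Y -> d.2 = p -> d = (Some W, p).
        move=> dY dp; apply/eqP; apply: contraTT le1 => neq.
        rewrite -ltnNge ltn_addr // (cardsD1 d) inE dY dp eqxx ltnS card_gt0.
        by apply/set0Pn; exists (Some W, p); rewrite !inE WY eqxx eq_sym neq.
      have nW : near_base W.
        case/orP: PW => // /eqP eqW; move: pWU; rewrite eqW => pW0.
        apply: contraTT le1; rewrite -ltnNge => /negPf nb.
        rewrite /L nb pW0 addn1 ltnS card_gt0; apply/set0Pn.
        by exists (Some W, p); rewrite inE WY eqxx.
      have [y yY WyU] := near_base_sub nW WZ; exists y => // W'.
      by move=> /uniqW-/(_ erefl)[->].
    have /properP[_ [z zZ zU]] := UZ; exists z; first by rewrite inE zU.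
    by move=> W WY; have := nW W; rewrite WY.
  have yU : y \notin U by move: yY; rewrite inE => /andP[].
  have [c cy] := exists_compatible yU.
  have [x [vx _ xa]] := omit_cell pU yY cy.
  exists (fun d => x d.1 d.2) => // -[[W|] s] dY; have := YX _ dY; rewrite inE //=.
  case/and4P=> WZ /eqP cW _ sWU; apply: xa => //.
  by have [sp | ] := eqVneq s p; [right; apply: Yp; rewrite -sp | left].
exists (fun o v => g (o, v)) => // W WZ cW PW s sWU.
by rewrite (gX (Some W, s)) // inE /= WZ cW eqxx /=; apply/andP.
Qed.

Section Merge.

Variable P : bool -> pred {set V}.
Hypothesis P_near : forall b W, near_base W -> P b W.

(** [S] lists the variables at which the two cells already agree; it will grow to all of
    [Z :\: U]. *)
Definition linked (S : seq V) (x : bool -> cell) :=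
  (forall b, valid (x b)) /\ {in S, x false None =1 x true None}.

Definition fixing_pair x := forall b, fixes (P b) (x b).

(* Among k + 1 requirements some p in U occurs at most once, in the i0-th pair
   say. That pair is taken to be x and all the others omit p. *)
Lemma chain_of_pairs S y x N : y \in Z :\: U -> linked S x -> fixing_pair x ->
  exists X : 'I_N.+1 -> bool -> cell,
    (forall i, linked S (X i) /\ fixing_pair (X i)) /\
    forall i j : 'I_N.+1, j = i.+1 :> nat ->
      X i true None y = X j false None y.
Proof.
move=> yY lx fx; have yZ : y \in Z by move: yY; rewrite inE => /andP[].
pose D := [set d : 'I_N.+1 * bool * option {set V} * V |
  if d.1.2 is Some W then
    [&& W \subset Z, #|W| == k, P d.1.1.2 W & d.2 \in W :&: U] else false].
pose K (g : 'I_N.+1 * bool * option {set V} * V -> B) :=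
  (forall i, linked S (fun b o v => g (i, b, o, v))) /\
  forall i j : 'I_N.+1, j = i.+1 :> nat ->
    g (i, true, None, y) = g (j, false, None, y).
have [||||g [gl gy] gD] := @baker_pixley B _ _ t K (fun d => a d.2) D.
- exact: arity_gt0.
- exact: t_nu.
- move=> F KF; split=> [i | i j ij].
    split=> [b | v vS].
      by apply: valid_comb => j; have [/(_ i)[]] := KF j.
    congr t; apply/ffunP=> j; rewrite !ffunE.
    by have [/(_ i)[_ /(_ v vS)]] := KF j.
  by congr t; apply/ffunP=> l; rewrite !ffunE; have [_ /(_ i j ij)] := KF l.
- move=> Y /subsetP YD; rewrite addn2 ltnS => cY.
  have [|p pU] := @sparse_index _ _ snd Y U set0.
    by rewrite cards0 cardU; lia.
  rewrite in_set0 addn0 => le1.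
  have [i0 Yi0] : exists i0, forall d, d \in Y -> d.2 = p -> d.1.1.1 = i0.
    have [|/set0Pn[d0]] := eqVneq [set d in Y | d.2 == p] set0.
      move=> Y0; exists ord0 => d dY dp.
      by have := in_set0 d; rewrite -Y0 inE dY dp eqxx.
    rewrite inE => /andP[d0Y d0p]; exists d0.1.1.1 => d dY dp.
    suff -> : d = d0 by [].
    by apply: (card_le1_eqP le1); rewrite inE ?d0Y ?d0p // dY dp eqxx.
  have compat b : compatible y (x b None y).
    apply: compatible_of_fixes => //; first by case: lx => /(_ b).
    by move=> W WZ cW nW; apply: (fx b) => //; apply: P_near.
  have [l [vl ly la]] := omit_cell pU yY (compat false).
  have [r [vr ry ra]] := omit_cell pU yY (compat true).
  (* Before [i0] both members of a pair are [l], after it both are [r]. At [y] these have the values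
     of [x false] and [x true], so the chain is unbroken at [i0]. *)
  pose sel (i : 'I_N.+1) b := if i < i0 then l else if i0 < i then r else x b.
  exists (fun d => sel d.1.1.1 d.1.1.2 d.1.2 d.2).
    split=> [i | i j ij] /=; rewrite /sel; last first.
      rewrite ij ltnS; case: (ltngtP i i0) => [lt_ii0 | gt_ii0 | /val_inj ->].
      - case: (ltngtP i.+1 i0) lt_ii0 => // _ _; by rewrite ly.
      - by rewrite ltnNge ltnW // ltnS ltnW.
      - by rewrite ltnNge leqnSn /= ry.
    have [vx xS] := lx.
    split=> [b | v vS] /=; first by case: ifP => _; [|case: ifP => _].
    by case: ifP => // _; case: ifP => // _; apply: xS.
  move=> [[[i b] [W|]] s] dY; have := YD _ dY; rewrite inE //=.
  case/and4P=> WZ /eqP cW PW sWU; rewrite /sel.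
  have outer : i != i0 -> s != p.
    by apply: contra_neq => sp; apply: (Yi0 _ dY).
  case: (ltngtP i i0) => [lt | gt | _].
  - by apply: la => //; left; apply: outer; rewrite -val_eqE neq_ltn lt.
  - by apply: ra => //; left; apply: outer; rewrite -val_eqE neq_ltn gt orbT.
  - exact: (fx b).
exists (fun i b o v => g (i, b, o, v)); split=> // i; split=> //.
move=> b W WZ cW PW s sWU.
by rewrite (gD (i, b, Some W, s)) // inE /= WZ cW eqxx PW.
Qed.

(** The loop lemma is applied to the relation [E] between the two values at [y]: a loop is a pair
    that agrees at [y] as well. *)
Lemma link_one_more S y x : y \in Z :\: U -> linked S x -> fixing_pair x ->
  exists2 x', linked (y :: S) x' & fixing_pair x'.
Proof.
move=> yY lx fx.
pose E c c' := `[< exists x', [/\ linked S x', fixing_pair x',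
  x' false None y = c & x' true None y = c'] >].
suff [c /asboolP[x' [[vx' x'S] fx' x'c x'c']]] : exists c, E c c.
  exists x' => //; split=> // v; rewrite inE => /orP[/eqP-> | /x'S //].
  by rewrite x'c x'c'.
have t_idem b : t [ffun=> b] = b.
  by apply: (near_unanimityP t_nu (i := Ordinal arity_gt0)) => j _; rewrite ffunE.
(* The pair at one index [i] may fail to fix its scopes: the other indices impose the values [a]
   through [t]. *)
have comb (u v : {ffun 'I_(k + 2) -> B}) i :
    (forall j, exists x', [/\ linked S x', j != i -> fixing_pair x',
       x' false None y = u j & x' true None y = v j]) -> E (t u) (t v).
  move=> /fin_all_exists[F FP]; apply/asboolP.
  exists (fun b o w => t [ffun j => F j b o w]); split.
  - split=> [b | w wS]; first by apply: valid_comb => j; have [[]] := FP j.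
    congr t; apply/ffunP=> j; rewrite !ffunE.
    by have [[_ xS] _ _ _] := FP j; apply: xS.
  - move=> b W WZ cW PW s sWU.
    apply: (near_unanimityP t_nu (i := i)) => j ji; rewrite ffunE.
    by have [_ /(_ ji b) fF _ _] := FP j; apply: fF.
  - by congr t; apply/ffunP=> j; rewrite ffunE; have [] := FP j.
  - by congr t; apply/ffunP=> j; rewrite ffunE; have [] := FP j.
apply: (loop_of_long_walks (t := t) (m := k + 2)) => //.
- move=> u v uv; apply: (comb u v (Ordinal arity_gt0)) => j.
  by have /asboolP[x' [? ? ? ?]] := uv j; exists x'.
- move=> u v i z uv uvi /asboolP[z' [lz _ zu _]]; apply: (comb u v i) => j.
  have [->|ji] := eqVneq j i; last first.
    by have /asboolP[x' [? ? ? ?]] := uv j ji; exists x'.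
  (* Both members are [z' false], which agrees with itself; as second member it may fail to fix
     [P true], which [comb] tolerates at [i]. *)
  exists (fun=> z' false); split; rewrite -?uvi //.
  by split=> // b; have [vz _] := lz; apply: vz.
- move=> N; have [X [lX yX]] := chain_of_pairs N yY lx fx.
  exists (fun i => X (inord i) false None y) => i iN; apply/asboolP.
  have [? ?] := lX (inord i); exists (X (inord i)); split=> //.
  by apply: yX; rewrite !inordK // ltnS ltnW.
Qed.

(** Once two cells agree on all of [Z :\: U], each scope can take its tuple from whichever cell
    fixes it. *)
Lemma merge_fixes : (forall b, exists2 x, valid x & fixes (P b) x) ->
  exists2 x, valid x & fixes (predU (P false) (P true)) x.
Proof.
move=> /fin_all_exists2[x0 vx0 fx0].
have [x [vx xY] fx] : exists2 x, linked (enum (Z :\: U)) x & fixing_pair x.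
  have: {subset enum (Z :\: U) <= Z :\: U} by move=> v; rewrite mem_enum.
  elim: (enum _) => [_|y s IHs ys]; first by exists x0.
  have [|x lx fx] := IHs; first by move=> v vs; apply: ys; rewrite inE vs orbT.
  by apply: link_one_more lx fx; apply: ys; rewrite inE eqxx.
have xN (W : {set V}) : W \subset Z -> {in W :\: U, x false None =1 x true None}.
  move=> WZ v; rewrite inE => /andP[vU vW]; apply: xY.
  by rewrite mem_enum inE vU (subsetP WZ).
exists (fun o : option {set V} =>
  if o is Some W then x (~~ P false W) (Some W) else x false None).
  move=> W WZ cW; case: (P false W) => /=.
    exact: vx.
  have [RW xW] := vx true W WZ cW; split=> // v vW.
  by rewrite xW // (xN W).
move=> W WZ cW PW; apply: (fx (~~ P false W)) => //; move: PW => /=.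
by case PW: (P false W).
Qed.

End Merge.

(** Merging the cells of single constraints one after another gives a cell that fixes every scope;
    its assignment outside [U], together with [a] on [U], is a solution. *)
Lemma extend_solution : exists2 f, {in U, f =1 a} & solves Z f.
Proof.
have fix_all (s : seq {set V}) : all (fun W : {set V} => #|W| == k) s ->
    exists2 x, valid x & fixes (predU near_base (mem s)) x.
  elim: s => [_|W s IHs /= /andP[/eqP cW /IHs sx]].
    have [x vx fx] := fix_one_constraint cardU; exists x => //.
    by move=> W WZ cW; rewrite /= orbF => nW; apply: fx; rewrite //= nW.
  pose P b := if b then predU near_base (mem s) else predU near_base (pred1 W).
  have [|[]//|x vx fx] := @merge_fixes P.
  - by move=> [] W' nW' /=; rewrite nW'.
  - exact: fix_one_constraint.
  exists x => // W' WZ' cW' /=; rewrite inE => PW'; apply: fx => //=.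
  by case/or3P: PW' => ->; rewrite ?orbT.
pose s := enum [pred W : {set V} | #|W| == k].
have [|x vx fx] := fix_all s; first by apply/allP=> W; rewrite mem_enum.
exists (fun v => if v \in U then a v else x None v) => [v -> // | W WZ cW].
have [RW xW] := vx W WZ cW; apply: R_local RW => v vW.
case: ifPn => vU; last by apply: xW; rewrite inE vU.
apply: fx; rewrite ?inE ?vW //= /s; apply/orP; right.
by rewrite mem_enum inE cW.
Qed.

End InductionStep.

Lemma local_to_global (Z U : {set V}) a : U \subset Z -> #|U| = k -> R U a ->
  exists2 f, {in U, f =1 a} & solves Z f.
Proof.
have [n] := ubnP #|Z|; elim: n Z U a => // n IHn Z U a le_Zn UZ cU RUa.
have [eqUZ | neUZ] := eqVneq U Z.
  exists a => // W WZ cW; suff -> : W = U by [].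
  by apply/eqP; rewrite eqEcard cU cW leqnn andbT eqUZ.
apply: (extend_solution _ cU RUa); first by rewrite properEneq neUZ.
move=> Z' U' a' ZZ'; apply: IHn.
exact: leq_trans (proper_card ZZ') le_Zn.
Qed.

End LocalToGlobal.

(** * Term operations in powers, and sensitivity from a near unanimity term *)

Lemma subuniverse_eval S (B : finAlgebra S) (X : {set B}) m (s : term S m)
    (v : {ffun 'I_m -> B}) :
  subuniverse X -> (forall j, v j \in X) -> eval s v \in X.
Proof.
move=> sX vX; elim: s => [i | o args IH] //=.
by apply: sX => j; rewrite ffunE.
Qed.

Lemma eval_power S (A : finAlgebra S) n m (s : term S m)
    (v : {ffun 'I_m -> power A n}) i :
  (eval s v : {ffun 'I_n -> A}) i =
  eval s [ffun j => (v j : {ffun 'I_n -> A}) i].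
Proof.
elim: s => [j | o args IH] /=; first by rewrite ffunE.
by rewrite ffunE; congr basic_op; apply/ffunP=> j; rewrite !ffunE IH.
Qed.

Lemma near_unanimity_power S (A : finAlgebra S) m :
  has_near_unanimity_term A m <-> has_near_unanimity_term (power A 2) m.
Proof.
split=> -[f [[s fs] f_nu]].
  exists (eval s); split; first by exists s.
  move=> i a b; apply/ffunP=> e; rewrite eval_power -fs.
  rewrite -[RHS](f_nu i (a e) (b e)); congr f.
  by apply/ffunP=> j; rewrite !ffunE; case: eqP.
exists (eval s); split; first by exists s.
move=> i a b.
have /ffunP/(_ ord0) := f_nu i [ffun=> a] [ffun=> b].
rewrite fs eval_power [RHS]ffunE => eq_a; rewrite -[RHS]eq_a; congr eval.
by apply/ffunP=> j; rewrite !ffunE; case: eqP; rewrite ffunE.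
Qed.

Definition scope_set (V B : finType) (c : constraint V B) : {set V} :=
  [set scope c i | i : 'I_(arity c)].

Lemma restrict_constraint (B : finType) (I : instance B)
    (Z : {set variable I}) (c : constraint (variable I) B) :
  scope_set c \subset Z -> constraints c ->
  exists2 sc : {ffun 'I_(arity c) -> variable (restrict Z)},
    forall i, val (sc i) = scope c i
    & constraints (i := restrict Z) (Constraint sc (relation c)).
Proof.
move=> cZ Ic; have sZ i : scope c i \in Z.
  by apply: (subsetP cZ); apply: imset_f.
exists [ffun i => exist _ (scope c i) (sZ i)] => [i|]; first by rewrite ffunE.
rewrite /=; suff -> : [ffun i => val ([ffun i => exist (fun x => x \in Z)
    (scope c i) (sZ i)] i)] = scope c by case: c Ic {cZ sZ}.
by apply/ffunP=> i; rewrite !ffunE.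
Qed.

Lemma sensitive_of_near_unanimity S (B : finAlgebra S) k (I : instance B) :
  1 < k -> has_near_unanimity_term B (k + 2) ->
  instance_over I -> kl_instance k (k + 1) I -> sensitive I.
Proof.
move=> k_gt1 [t [[s ts] t_nu]] I_over [[Ik Iex Iuniq] Isens].
pose R (W : {set variable I}) (f : variable I -> B) := forall c, constraints c ->
  scope_set c = W -> [ffun i => f (scope c i)] \in relation c.
have R_local (W : {set variable I}) (f g : variable I -> B) :
    {in W, f =1 g} -> R W f -> R W g.
  move=> fg Rf c Ic cW; rewrite (_ : [ffun i => _] = [ffun i => f (scope c i)]).
    exact: Rf.
  by apply/ffunP=> i; rewrite !ffunE fg // -cW imset_f.
have R_closed (W : {set variable I}) (F : 'I_(k + 2) -> variable I -> B) :
    (forall j, R W (F j)) -> R W (fun v => t [ffun j => F j v]).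
  move=> RF c Ic cW.
  pose args := [ffun j => [ffun i => F j (scope c i)]] :
    {ffun 'I_(k + 2) -> power B (arity c)}.
  suff -> : [ffun i => t [ffun j => F j (scope c i)]] = eval s args.
    apply: (@subuniverse_eval _ (power B (arity c))); first exact: I_over.
    by move=> j; rewrite ffunE; apply: RF.
  apply/ffunP=> i; rewrite ffunE eval_power ts; congr eval.
  by apply/ffunP=> j; rewrite !ffunE.
have R_extends (W : {set variable I}) v (f : variable I -> B) : #|W| = k ->
    v \notin W -> R W f ->
    exists2 g, {in W, g =1 f} & solves k R (v |: W) g.
  move=> cW vW Rf; have [c Ic eqcW] := Iex W cW.
  have card_Z : #|v |: W| = k + 1 by rewrite cardsU1 vW cW addnC.
  have cZ : scope_set c \subset v |: W by rewrite /scope_set eqcW subsetUr.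
  have [sc scE Isc] := restrict_constraint cZ Ic.
  have [h [sol_h hf]] := Isens _ card_Z _ Isc _ (Rf c Ic eqcW).
  (* [insub] carries the solution [h] from the subtype back to all variables; [f] is a default
     outside it. *)
  exists (fun u => if insub u is Some w then h w else f u) => [u uW | W' W'Z cW'].
    have: u \in scope_set c by rewrite /scope_set eqcW.
    case/imsetP=> i _ ->; have := hf i; rewrite /= ffunE => <-.
    by rewrite -scE valK.
  move=> c' Ic' eqcW'; rewrite -eqcW' in W'Z.
  have [sc' sc'E Isc'] := restrict_constraint W'Z Ic'.
  have /= := sol_h _ Isc'; rewrite (_ : [ffun i => _] =
    [ffun i => if insub (scope c' i) is Some w then h w else f (scope c' i)]) //.
  by apply/ffunP=> i; rewrite !ffunE -sc'E valK.
move=> c Ic u uc; have [ac inj_c] := Ik c Ic.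
have i0 : 'I_(arity c) by rewrite ac; apply: Ordinal (ltnW k_gt1).
(* The tuple [u] becomes a total assignment, with default value [u i0] off the scope. *)
pose a v := if [pick i | scope c i == v] is Some i then u i else u i0.
have aE i : a (scope c i) = u i.
  rewrite /a; case: pickP => [j /eqP/inj_c -> // | /(_ i)].
  by rewrite eqxx.
have card_scope (c' : constraint (variable I) B) :
    constraints (i := I) c' -> #|scope_set c'| = k.
  by move=> Ic'; have [eqk inj] := Ik c' Ic'; rewrite card_imset // card_ord.
(* The other constraints on the same set agree with [c] by uniformity, through the bijection [p] of
   indices. *)
have Ra : R (scope_set c) a.
  move=> d Id eqdc.
  have /fin_all_exists[p pP] : forall i, exists j, scope d i = scope c j.
    move=> i; have: scope d i \in scope_set c by rewrite -eqdc imset_f.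
    by case/imsetP=> j _ ->; exists j.
  have [ad inj_d] := Ik d Id.
  have p_bij : bijective p.
    apply: inj_card_bij; last by rewrite !card_ord ac ad.
    by move=> i j eqp; apply: inj_d; rewrite !pP eqp.
  rewrite (Iuniq c d Ic Id p p_bij pP u) in uc.
  rewrite (_ : [ffun i => _] = [ffun i => u (p i)]) //.
  by apply/ffunP=> i; rewrite !ffunE pP aE.
have [f fa sf] := local_to_global k_gt1 t_nu R_local R_closed R_extends
  (subsetT _) (card_scope c Ic) Ra.
exists f; split=> [d Id | i]; last by rewrite fa ?imset_f.
exact: (sf _ (subsetT _) (card_scope d Id) d Id erefl).
Qed.

(** * Instances detecting subpowers *)

(* Used both for the coordinates of a subpower and for the variables of an
   instance: as a coordinate, [inr (i, j)] is the entry (i, j) of a 2 x 2 square; as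
   a variable, [inr (false, i)] is its row i and [inr (true, j)] its column j. *)
Definition grid n := ('I_n + bool * bool)%type.

Definition encode S (A : finAlgebra S) n (f : grid n -> A) (v : grid n) :
    power A 2 :=
  match v with
  | inl s => [ffun=> f (inl s)]
  | inr (false, i) => [ffun e : 'I_2 => f (inr (i, e != ord0))]
  | inr (true, j) => [ffun e : 'I_2 => f (inr (e != ord0, j))]
  end.

Section SensitiveImpliesDetermined.

Variables (S : signature) (A : finAlgebra S) (n : nat).

Definition subpower (D : Type) (Q : (D -> A) -> Prop) :=
  forall (o : S) (F : 'I_(symbol_arity o) -> D -> A), (forall j, Q (F j)) ->
  Q (fun x => basic_op (o := o) [ffun j => F j x]).

Definition almost (D : Type) (Q : (D -> A) -> Prop) (f : D -> A) :=
  forall x, exists2 g, Q g & forall y, y <> x -> g y = f y.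

Lemma almost_subpower (D : Type) (Q : (D -> A) -> Prop) :
  subpower Q -> subpower (almost Q).
Proof.
move=> sQ o F QF x.
have /fin_all_exists2[G QG GF] : forall j, exists2 g,
  Q g & forall y, y <> x -> g y = F j y by move=> j; apply: QF.
exists (fun y => basic_op (o := o) [ffun j => G j y]); first exact: sQ.
by move=> y yx; congr basic_op; apply/ffunP=> j; rewrite !ffunE GF.
Qed.

Lemma encode_op (o : S) (F : 'I_(symbol_arity o) -> grid n -> A) v :
  encode (fun x => basic_op (o := o) [ffun j => F j x]) v =
  basic_op (f := power A 2) (o := o) [ffun j => encode (F j) v].
Proof.
apply/ffunP=> e; rewrite [RHS]ffunE.
by case: v => [s | [[] i]]; rewrite ffunE; congr basic_op; apply/ffunP=> j;
  rewrite !ffunE.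
Qed.

Definition but2 (u v : grid n) : {set grid n} := ~: [set u; v].

Lemma card_but2 (u v : grid n) : u != v -> #|but2 u v| = n.+2.
Proof.
move=> uv; rewrite /but2 cardsCs setCK cards2 uv.
by rewrite card_sum card_prod card_bool card_ord addn4.
Qed.

(** The scope made of both columns and all of ['I_n]; its variables see every coordinate, as do
    those of [rows]. *)
Definition columns : {set grid n} := but2 (inr (false, false)) (inr (false, true)).

Definition rows : {set grid n} := but2 (inr (true, false)) (inr (true, true)).

Lemma card_columns : #|columns| = n.+2.
Proof. exact: card_but2. Qed.

Lemma card_rows : #|rows| = n.+2.
Proof. exact: card_but2. Qed.

Variable Q : (grid n -> A) -> Prop.
Hypothesis Q_subpower : subpower Q.

(** Demanding [Q] on a single scope leaves room for any tuple of [almost Q] on the rows, while a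
    solution must meet [Q] on the columns. *)
Definition allowed (W : {set grid n}) := if W == columns then Q else almost Q.

Lemma almost_of (f : grid n -> A) : Q f -> almost Q f.
Proof. by move=> Qf x; exists f. Qed.

Lemma allowed_of W f : Q f -> allowed W f.
Proof. by rewrite /allowed; case: ifP => // _; apply: almost_of. Qed.

(** All orderings of a scope are included, so that no enumeration of it has to be singled out. *)
Definition grid_instance : instance (power A 2) :=
  @Instance (power A 2) (grid n) (fun c =>
    [/\ arity c = n.+2, injective (scope c)
      & forall u : {ffun 'I_(arity c) -> power A 2}, (u \in relation c) <->
          exists2 f, allowed (scope_set c) f &
            forall i, u i = encode f (scope c i)]).

Lemma grid_constraint (W : {set grid n}) : #|W| = n.+2 ->
  exists2 c, constraints (i := grid_instance) c & scope_set c = W.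
Proof.
move=> cW; pose sc : {ffun 'I_n.+2 -> grid n} :=
  [ffun i => enum_val (cast_ord (esym cW) i)].
have inj_sc : injective sc.
  by move=> i j; rewrite !ffunE => /enum_val_inj/cast_ord_inj.
have scW : [set sc i | i : 'I_n.+2] = W.
  apply/eqP; rewrite eqEcard card_imset // card_ord cW leqnn andbT.
  by apply/subsetP=> v /imsetP[i _ ->]; rewrite ffunE enum_valP.
exists (Constraint sc [set u : {ffun 'I_n.+2 -> power A 2} |
  `[< exists2 f, allowed W f & forall i, u i = encode f (sc i) >]]) => //.
split=> // u; rewrite inE /scope_set /= scW; split=> [/asboolP // | ?].
exact/asboolP.
Qed.

Lemma grid_instance_over : instance_over grid_instance.
Proof.
move=> c [_ _ relc] o args argsc; apply/relc.
have /fin_all_exists2[F aF argsF] := fun j => (relc (args j)).1 (argsc j).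
exists (fun x => basic_op (o := o) [ffun j => F j x]).
  rewrite /allowed in aF *; case: ifP aF => _ aF; first exact: Q_subpower.
  exact: almost_subpower.
move=> i; rewrite encode_op ffunE; congr basic_op.
by apply/ffunP=> j; rewrite !ffunE argsF.
Qed.

Lemma grid_instance_uniform : uniform n.+2 grid_instance.
Proof.
split=> [c [] // | W cW | c d [_ _ relc] [_ _ reld] s s_bij ds u].
  by have [c] := grid_constraint cW; exists c.
have eq_scope : scope_set d = scope_set c.
  have [s' sK s'K] := s_bij.
  apply/setP=> v; apply/imsetP/imsetP=> -[i _ ->].
    by exists (s i); rewrite -?ds.
  by exists (s' i); rewrite // ds s'K.
have [s' sK s'K] := s_bij.
apply/idP/idP=> [/relc[f af uf] | /reld[f af uf]].
  by apply/reld; exists f => [|i]; rewrite ?eq_scope // ffunE ds.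
apply/relc; exists f => [|i]; first by rewrite -eq_scope.
by have := uf (s' i); rewrite ffunE ds s'K.
Qed.

(* A scope other than the columns which misses a row misses a coordinate. *)
Lemma almost_on_scope (W : {set grid n}) i f : #|W| = n.+2 -> W != columns ->
  inr (false, i) \notin W -> almost Q f ->
  exists2 g, Q g & {in W, encode g =1 encode f}.
Proof.
move=> cW neqW iW Qf.
have /subsetPn[v] : ~~ (columns \subset W).
  apply: contra neqW => sW.
  by rewrite eq_sym eqEcard sW cW card_columns leqnn.
rewrite !inE negb_or => /andP[v0 v1] vW.
(* [x] is a coordinate seen only by variables outside [W]: [v] itself, or the entry where the column
   [v] meets row [i]. *)
have [x xP] : exists x, forall g : grid n -> A,
    (forall y, y <> x -> g y = f y) -> {in W, encode g =1 encode f}.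
  case: v v0 v1 vW => [s _ _ | [[] j] v0 v1] vW; last by case: j v0 v1 {vW}.
    exists (inl s) => g gf u uW.
    case: u uW => [s' | [[] i']] uW; apply/ffunP=> e; rewrite !ffunE gf //.
    by move=> [ss']; rewrite -ss' uW in vW.
  exists (inr (i, j)) => g gf u uW.
  case: u uW => [s' | [[] i']] uW; apply/ffunP=> e; rewrite !ffunE gf //.
    by move=> [_ ij]; rewrite -ij uW in vW.
  by move=> [ii' _]; rewrite -ii' uW in iW.
by have [g Qg gf] := Qf x; exists g => //; apply: xP.
Qed.

(** If [Z] misses part of the columns, [almost Q] suffices on all its scopes. Otherwise the variable
    outside [Z] is a row, so a scope in [Z] other than the columns misses that row and its tuple
    comes from a member of [Q]. *)
Lemma grid_kl_instance : kl_instance n.+2 (n.+2 + 1) grid_instance.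
Proof.
split=> [|Z cZ c Ic u uc]; first exact: grid_instance_uniform.
move: (Ic) => [ac inj_c relc].
set c0 := Constraint _ _ in ac inj_c relc.
have c0Z : scope_set c0 \subset Z.
  by apply/subsetP=> v /imsetP[i _ ->]; rewrite /= ffunE; apply: valP.
have cc0 : #|scope_set c0| = n.+2 by rewrite card_imset // card_ord.
have [f af uf] := (relc u).1 uc.
have [v vZ] : exists v, v \notin Z.
  apply/existsP; apply: contraT; rewrite negb_exists => /forallP allZ.
  suff : #|[set: grid n]| <= n.+2 + 1.
    by rewrite cardsT card_sum card_prod card_bool card_ord; lia.
  by rewrite -cZ subset_leq_card //; apply/subsetP=> v _; have := allZ v; rewrite negbK.
have [g gf Qg] : exists2 g, {in scope_set c0, encode g =1 encode f} &
    Q g \/ almost Q g /\ ~~ (columns \subset Z).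
  have [colZ | colZ] := boolP (columns \subset Z); last first.
    exists f => //; right; split=> //; move: af; rewrite /allowed.
    by case: ifP => // _; apply: almost_of.
  move: af; rewrite /allowed; case: eqVneq => [_ Qf | neq af].
    by exists f => //; left.
  have [i vi] : exists i, v = inr (false, i).
    have: v \notin columns by apply: contra vZ; apply: (subsetP colZ).
    rewrite !inE negbK => /orP[]/eqP->; last by exists true.
    by exists false.
  have [|g Qg gf] := almost_on_scope cc0 neq (i := i) _ af; last by exists g; auto.
  by rewrite -vi; apply: contra vZ; apply: (subsetP c0Z).
exists (fun w => encode g (val w)); split=> [d Id | i]; last first.
  rewrite uf; have := gf (val (scope c i)); rewrite /= ffunE; apply.
  by apply/imsetP; exists i => //; rewrite ffunE.
move: Id => [_ _ reld]; apply/reld; exists g; last by move=> i; rewrite !ffunE.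
case: Qg => [|[Qg colZ]]; first exact: allowed_of.
rewrite /allowed; case: eqP => // eqcol; move: colZ; rewrite -eqcol.
case/negP; apply/subsetP=> w /imsetP[i _ ->].
by rewrite /= ffunE; apply: valP.
Qed.

(** The tuple of [f] on the rows extends to a solution, which on the columns encodes some [g] in
    [Q]; other scopes force [g] to equal [f] on the square. *)
Lemma determined_of_sensitive : sensitive grid_instance ->
  forall f, almost Q f -> exists2 g, Q g & g =1 f.
Proof.
move=> sens f Qf.
have on_scope h (W : {set grid n}) : solution (I := grid_instance) h ->
    #|W| = n.+2 -> exists2 g, allowed W g & {in W, h =1 encode g}.
  move=> sol_h cW; have [c Ic eqcW] := grid_constraint cW.
  have := sol_h c Ic; have [_ _ relc] := Ic.
  move=> /relc[g ag hg]; exists g => [|v]; first by rewrite -eqcW.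
  by rewrite -eqcW => /imsetP[i _ ->]; have := hg i; rewrite ffunE.
have rows_col : rows != columns.
  by apply/eqP=> /setP/(_ (inr (false, false))); rewrite !inE.
have [c Ic eqc] := grid_constraint card_rows.
have [_ _ relc] := Ic.
have fc : [ffun i => encode f (scope c i)] \in relation c.
  apply/relc; exists f => [|i]; last by rewrite ffunE.
  by rewrite eqc /allowed (negPf rows_col).
have [h [sol_h hf]] := sens c Ic _ fc.
have {hf} h_rows v : v \in rows -> h v = encode f v.
  by rewrite -eqc => /imsetP[i _ ->]; have := hf i; rewrite ffunE.
have [g] := on_scope h columns sol_h card_columns.
rewrite /allowed eqxx => Qg h_cols; exists g => // -[s | [i j]].
  have := h_rows (inl s); rewrite h_cols ?inE // => /(_ isT)/ffunP/(_ ord0).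
  by rewrite !ffunE.
(* This scope contains both row [i] and column [j], so a single [r] carries the entry [(i, j)] from
   [f] to [g]. *)
have [|r _ hr] := on_scope h (but2 (inr (false, ~~ i)) (inr (true, ~~ j))) sol_h.
  by rewrite card_but2.
pose I2 (b : bool) : 'I_2 := if b then ord_max else ord0.
have I2K b : (I2 b != ord0) = b by case: b.
have /ffunP/(_ (I2 i)) : encode g (inr (true, j)) = encode r (inr (true, j)).
  by rewrite -h_cols -?hr // !inE; case: (j); case: (i).
have /ffunP/(_ (I2 j)) : encode f (inr (false, i)) = encode r (inr (false, i)).
  by rewrite -h_rows -?hr // !inE; case: (j); case: (i).
by rewrite !ffunE !I2K => -> ->.
Qed.

End SensitiveImpliesDetermined.

(* Baker-Pixley for all powers, from the power with exponent n.+4: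
   by idempotence, the coordinates outside a set of that size can be fixed. *)
Lemma determined_by_projections S (A : finAlgebra S) n (D : finType)
    (K : (D -> A) -> Prop) (f : D -> A) :
  idempotent_algebra A ->
  (forall Q : (grid n -> A) -> Prop, subpower Q ->
     forall h, almost Q h -> exists2 g, Q g & g =1 h) ->
  subpower K ->
  (forall Y : {set D}, #|Y| < n.+4 -> exists2 g, K g & {in Y, g =1 f}) ->
  exists2 g, K g & g =1 f.
Proof.
move=> idemA detA sK Kf.
suff: forall Y : {set D}, exists2 g, K g & {in Y, g =1 f}.
  by case/(_ setT) => g Kg gf; exists g => // x; apply: gf.
move=> Y; have [m] := ubnP #|Y|; elim: m Y => // m IHm Y le_Ym.
have [lt_Y | le_Y] := ltnP #|Y| n.+4; first exact: Kf.
have card_grid : #|{: grid n}| <= #|Y|.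
  by rewrite card_sum card_prod card_bool card_ord addn4.
pose e (x : grid n) : D := enum_val (widen_ord card_grid (enum_rank x)).
have eY x : e x \in Y by apply: enum_valP.
have e_inj : injective e.
  by move=> x y /enum_val_inj/(congr1 val)/= /val_inj/enum_rank_inj.
(* Members of [K] are read along [e] while they keep the values of [f] on the rest of [Y];
   idempotence makes this a subpower. *)
pose Q (h : grid n -> A) := exists2 g, K g &
  (forall x, g (e x) = h x) /\ {in Y, forall d, d \notin codom e -> g d = f d}.
have sQ : subpower Q.
  move=> o F /fin_all_exists2[G KG GF].
  exists (fun d => basic_op (o := o) [ffun j => G j d]); first exact: sK.
  split=> [x | d dY de].
    by congr basic_op; apply/ffunP=> j; rewrite !ffunE; have [->] := GF j.
  rewrite -[RHS](idemA o); congr basic_op; apply/ffunP=> j; rewrite !ffunE.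
  by have [_ ->] := GF j.
have [x|h [g Kg [gh gf]] hf] := detA Q sQ (f \o e).
  have [|g Kg gf] := IHm (Y :\ e x); first by rewrite (cardsD1 (e x)) eY in le_Ym.
  exists (g \o e) => [|y yx]; last first.
    by apply: gf; rewrite !inE eY (inj_eq e_inj) andbT; apply/eqP.
  exists g => //; split=> // d dY de; apply: gf; rewrite !inE dY andbT.
  by apply: contraNneq de => ->; apply: codom_f.
exists g => // d dY; have [/codomP[x ->] | /gf->//] := boolP (d \in codom e).
by rewrite gh hf.
Qed.

(* The near unanimity identities are equations indexed by D; fewer than m of them
   leave some variable j undisturbed, so that the j-th projection satisfies them. *)
Lemma near_unanimity_of_determined S (A : finAlgebra S) n :
  idempotent_algebra A ->
  (forall Q : (grid n -> A) -> Prop, subpower Q ->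
     forall h, almost Q h -> exists2 g, Q g & g =1 h) ->
  has_near_unanimity_term A n.+4.
Proof.
move=> idemA detA; pose D := ('I_n.+4 * (A * A))%type.
pose row (d : D) := [ffun j : 'I_n.+4 => if j == d.1 then d.2.2 else d.2.1].
pose K (g : D -> A) := exists s : term S n.+4, forall d, g d = eval s (row d).
have sK : subpower K.
  move=> o F /fin_all_exists[s sF]; exists (App s) => d /=.
  by congr basic_op; apply/ffunP=> j; rewrite !ffunE sF.
have [Y cY | g [s sg] gf] :=
    determined_by_projections (f := fun d : D => d.2.1) idemA detA sK.
  have [j jY] : exists j, j \notin [set d.1 | d in Y].
    apply/existsP; apply: contraLR cY; rewrite negb_exists -leqNgt => /forallP allY.
    rewrite -[X in X <= _]card_ord -cardsT.
    apply: leq_trans (leq_imset_card fst (mem Y)).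
    by apply: subset_leq_card; apply/subsetP=> j _; have := allY j; rewrite negbK.
  exists (fun d => row d j) => [|d dY]; first by exists (Var S j).
  by rewrite ffunE; case: eqP jY => // ->; rewrite imset_f.
exists (eval s); split; first by exists s.
by move=> i a b; rewrite -[RHS](gf (i, (a, b))) sg.
Qed.

Theorem theorem12 (S : signature) (A : finAlgebra S) (k : nat)
    (idemA : idempotent_algebra A) (k_gt1 : 1 < k) :
  [/\ has_near_unanimity_term A (k + 2) <->
        has_near_unanimity_term (power A 2) (k + 2),
      has_near_unanimity_term A (k + 2) <->
        (forall I : instance (power A 2),
           instance_over I -> kl_instance k (k + 1) I -> sensitive I)
    & (forall I : instance (power A 2),
         instance_over I -> kl_instance k (k + 1) I -> sensitive I) <->
        (forall I : instance (power A 2),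
           instance_over I -> kl_instance k (k + 1) I ->
           #|variable I| = k + 2 -> sensitive I)].
Proof.
have nu_square := near_unanimity_power A (k + 2).
have sens_of_nu : has_near_unanimity_term A (k + 2) ->
    forall I : instance (power A 2),
    instance_over I -> kl_instance k (k + 1) I -> sensitive I.
  move=> /nu_square nuA2 I; exact: sensitive_of_near_unanimity nuA2.
have nu_of_sens : (forall I : instance (power A 2),
    instance_over I -> kl_instance k (k + 1) I ->
    #|variable I| = k + 2 -> sensitive I) -> has_near_unanimity_term A (k + 2).
  (* Writing [k] as [n.+2] makes the grid, ['I_n] and a square of four, have exactly [k + 2]
     elements. *)
  case: k k_gt1 {nu_square sens_of_nu} => [|[|n]] // _ sens.
  rewrite addn2; apply: near_unanimity_of_determined => // Q sQ.
  apply: determined_of_sensitive; apply: sens.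
  - exact: grid_instance_over.
  - exact: grid_kl_instance.
  - by rewrite card_sum card_prod card_bool card_ord addn4 addn2.
by split=> //; split=> [| sens]; auto.
Qed.
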